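(* Let $\varphi:\mathbf{ST}_+\to\mathcal MMR_+$ be the linear map with $\varphi(1)=1$ and $\varphi(f)=\mathrm{std}_{\mathcal M}[f^{-1}(1),\dots,f^{-1}(r)]$ for $f\in\mathbf{ST}_n^r$. Then $\varphi$ is surjective onto the basis of $\mathcal M$-permutations, and for all $f\in\mathbf{ST}_n$, $g\in\mathbf{ST}_m$: (1) $\varphi(f\prec_qg)=\varphi(f)\prec_q\varphi(g)$; (2) $\varphi(f\cdot_qg)=\varphi(f)\cdot_q\varphi(g)$; (3) $\varphi(f\succ_qg)=\varphi(f)\succ_q\varphi(g)$; (4) $\Delta(\varphi(f))=(\varphi\otimes\varphi)(\Delta(f))$.
   Context: Words: maps $h:[n]\to\mathbb{Z}_{>0}$ identified with $(h(1),\dots,h(n))$; $\max(h)$ largest value; $hk$ concatenation; $\cap(h,k)=|\mathrm{Im}(h)\cap\mathrm{Im}(k)|$; $h$ surjective if $\mathrm{Im}(h)=[\max(h)]$; $\mathrm{std}(h)$ the unique surjective word $s$ with $h(i)<h(j)\iff s(i)<s(j)$. $\mathbf{ST}(q)$: $\mathbf{ST}_n^r$ the surjections $[n]\to[r]$, $\mathbf{ST}_n=\bigcup_r\mathbf{ST}_n^r$, $\mathbf{ST}=\bigoplus_{n\ge1}\mathbb{K}[\mathbf{ST}_n]$, $\mathbf{ST}_+=\mathbf{ST}\oplus\mathbb{K}1$. $f\succ_qg=\sum_{\max(h)<\max(k)}q^{\cap(h,k)}hk$, $f\cdot_qg=\sum_{\max(h)=\max(k)}q^{\cap(h,k)-1}hk$,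 $f\prec_qg=\sum_{\max(h)>\max(k)}q^{\cap(h,k)}hk$, over pairs of words $(h,k)$ with $hk$ surjective, $\mathrm{std}(h)=f$, $\mathrm{std}(k)=g$. Coproduct: $\Delta(1)=1\otimes1$; for $f\in\mathbf{ST}_n^r$, $\Delta(f)=\sum_{j=0}^rf|^{[j]}\otimes\mathrm{std}(f|^{\{j+1,\dots,r\}})$, with $f|^K=(f(j_1),\dots,f(j_l))$, $\{j_1<\dots<j_l\}=f^{-1}(K)$, empty word $=1$. $\mathcal MMR(q)$: an $\mathcal M$-permutation of $n$ is an ordered sequence $(B_1,\dots,B_m)$ of nonempty pairwise disjoint subsets with union $[n]$ such that no $i,i+1$ lie in the same block; $S^{\mathcal M}_n$ their set, $\mathcal MMR=\bigoplus_{n\ge1}\mathbb{K}[S^{\mathcal M}_n]$, $\mathcal MMR_+=\mathcal MMR\oplus\mathbb{K}1$. Restriction $W|_J=(W_1\cap J,\dots,W_l\cap J)$ with empty blocks deleted. $\mathrm{std}_{\mathcal M}$ of a sequence $C=(C_1,\dots,C_p)$ of nonempty disjoint finite subsets of $\mathbb{Z}_{>0}$ (empty sets in the input are first deleted): with $s_1<\dots<s_k$ the elements of $\bigcup C_c$ and $w(t)=c$ iff $s_t\in C_c$, delete from $w$ each letter equal to its predecessor to get $w'$ of length $l$, and set $\mathrm{std}_{\mathcal M}(C)=(w'^{-1}(1),\dots,w'^{-1}(p))\in S^{\mathcal M}_l$; $\mathrm{std}_{\mathcal M}$ of the empty sequence is $1$. Products for $B\in S^{\mathcal M}_n$, $D\in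 S^{\mathcal M}_m$: let $\mathcal W(B,D)$ be the pairs $(W,S)$ with either $W\in S^{\mathcal M}_{n+m}$, $S=\{n+1,\dots,n+m\}$, or $W\in S^{\mathcal M}_{n+m-1}$, $S=\{n,\dots,n+m-1\}$, and $W|_{[n]}=B$, $\mathrm{std}_{\mathcal M}(W|_S)=D$; for $W=(W_1,\dots,W_l)$ let $\cap^W_{B,D}=\#\{j:W_j\cap[n]\ne\emptyset\ne W_j\cap S\}$. $B\succ_qD=\sum_{W_l\cap[n]=\emptyset}q^{\cap^W_{B,D}}W$, $B\cdot_qD=\sum_{W_l\cap[n]\ne\emptyset\ne W_l\cap S}q^{\cap^W_{B,D}-1}W$, $B\prec_qD=\sum_{W_l\cap S=\emptyset}q^{\cap^W_{B,D}}W$, sums over $\mathcal W(B,D)$. Coproduct: $\Delta(1)=1\otimes1$ and for $B=(B_1,\dots,B_l)$, $\Delta(B)=\sum_{i=0}^l\mathrm{std}_{\mathcal M}(B_1,\dots,B_i)\otimes\mathrm{std}_{\mathcal M}(B_{i+1},\dots,B_l)$. *)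

(* Defs.v *)
From HB Require Import structures.
From mathcomp Require Import all_boot all_order all_algebra.
Set Implicit Arguments. Unset Strict Implicit. Unset Printing Implicit Defensive.
Import Order.TTheory GRing.Theory Num.Theory.
Local Open Scope ring_scope.

(* ---------- Formal linear combinations ----------
   An element of K[T] is represented by a finite list of (coefficient, basis
   element) pairs; two such lists denote the same vector iff all their
   coefficients agree. *)
Definition lincomb (R : Type) (T : Type) := seq (R * T).

Definition lc_coef (R : nmodType) (T : eqType) (x : lincomb R T) (t : T) : R :=
  \sum_(p <- x | p.2 == t) p.1.

Definition lc_eq (R : nmodType) (T : eqType) (x y : lincomb R T) : Prop :=
  forall t, lc_coef x t = lc_coef y t.

Definition lc_map (R : Type) (T U : Type) (F : T -> U) (x : lincomb R T)
  : lincomb R U := [seq (p.1, F p.2) | p <- x].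

(* A word h : [n] -> Z_{>0} is the list (h(1),...,h(n)); the empty word is 1. *)
Definition maxw (h : seq nat) : nat := foldr maxn 0%N h.

Definition is_surjw (h : seq nat) : bool :=
  all (fun i => i \in h) (iota 1 (maxw h)) && (0%N \notin h).

Definition stdw (h : seq nat) : seq nat :=
  [seq size (undup [seq y <- h | (y <= x)%N]) | x <- h].

Definition capw (h k : seq nat) : nat := size (undup [seq x <- h | x \in k]).

Fixpoint allseqs (k : nat) (vals : seq nat) : seq (seq nat) :=
  if k is k'.+1 then [seq x :: s | x <- vals, s <- allseqs k' vals]
  else [:: [::]].

(* all surjective words of length L (their values are necessarily <= L) *)
Definition surjwords (L : nat) : seq (seq nat) :=
  [seq w <- allseqs L (iota 1 L) | is_surjw w].

Section ST.
Variables (R : fieldType) (q : R).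

(* Sums over pairs (h,k) with hk surjective, std h = f, std k = g:
   these are exactly w = hk ranging over surjective words of length n+m,
   with h = take n w, k = drop n w. *)
Definition ST_succ (f g : seq nat) : lincomb R (seq nat) :=
  let n := size f in let m := size g in
  [seq (q ^+ capw (take n w) (drop n w), w)
   | w <- surjwords (n + m)
   & [&& stdw (take n w) == f, stdw (drop n w) == g
       & (maxw (take n w) < maxw (drop n w))%N]].

Definition ST_dot (f g : seq nat) : lincomb R (seq nat) :=
  let n := size f in let m := size g in
  [seq (q ^+ (capw (take n w) (drop n w)).-1, w)
   | w <- surjwords (n + m)
   & [&& stdw (take n w) == f, stdw (drop n w) == g
       & maxw (take n w) == maxw (drop n w)]].

Definition ST_prec (f g : seq nat) : lincomb R (seq nat) :=
  let n := size f in let m := size g in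
  [seq (q ^+ capw (take n w) (drop n w), w)
   | w <- surjwords (n + m)
   & [&& stdw (take n w) == f, stdw (drop n w) == g
       & (maxw (drop n w) < maxw (take n w))%N]].

Definition ST_cop (f : seq nat) : lincomb R (seq nat * seq nat) :=
  [seq (1, ([seq x <- f | (x <= j)%N], stdw [seq x <- f | (j < x)%N]))
   | j <- iota 0 (maxw f).+1].

End ST.

(* ---------- M-permutations ----------
   A finite subset of Z_{>0} is represented by its strictly increasing list of
   elements; an M-permutation (B_1,...,B_m) is the list of its blocks. The
   unit 1 of MMR_+ is the empty list of blocks. *)
Definition is_Mperm (N : nat) (B : seq (seq nat)) : bool :=
  [&& all (fun b => (b != [::]) && sorted ltn b) B,
      perm_eq (flatten B) (iota 1 N)
    & all (fun b => all (fun i => i.+1 \notin b) b) B].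

Definition blocks_of (N : nat) (w : seq nat) : seq (seq nat) :=
  [seq [seq i <- iota 1 N | nth 0%N w i.-1 == c] | c <- iota 1 (maxw w)].

(* all M-permutations of N (each ordered set partition comes from exactly one
   surjective word) *)
Definition Mperms (N : nat) : seq (seq (seq nat)) :=
  [seq blocks_of N w | w <- surjwords N & is_Mperm N (blocks_of N w)].

Definition restrictM (J : pred nat) (W : seq (seq nat)) : seq (seq nat) :=
  [seq b <- [seq [seq x <- b | J x] | b <- W] | b != [::]].

Definition stdM (C : seq (seq nat)) : seq (seq nat) :=
  let C' := [seq b <- C | b != [::]] in
  let elems := sort leq (flatten C') in
  let w := [seq find (fun b => x \in b) C' | x <- elems] in
  let w' := [seq nth 0%N w i | i <- iota 0 (size w)
             & (i == 0%N) || (nth 0%N w i != nth 0%N w i.-1)] in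
  [seq [seq i.+1 | i <- iota 0 (size w') & nth 0%N w' i == c]
   | c <- iota 0 (size C')].

Definition Msize (B : seq (seq nat)) : nat := size (flatten B).

Definition inS (lo m : nat) : pred nat := fun x => (lo <= x)%N && (x < lo + m)%N.

(* The set W(B,D): pairs (W,S), S encoded by its least element lo. *)
Definition Wset (B D : seq (seq nat)) : seq (seq (seq nat) * nat) :=
  let n := Msize B in let m := Msize D in
  let cond W lo := (restrictM (fun x => (x <= n)%N) W == B)
                   && (stdM (restrictM (inS lo m) W) == D) in
  [seq (W, n.+1) | W <- Mperms (n + m) & cond W n.+1]
  ++ [seq (W, n) | W <- Mperms (n + m).-1 & cond W n].

Definition capM (n m lo : nat) (W : seq (seq nat)) : nat :=
  count (fun b => has (fun x => (x <= n)%N) b && has (inS lo m) b) W.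

Section MMR.
Variables (R : fieldType) (q : R).

Definition M_succ (B D : seq (seq nat)) : lincomb R (seq (seq nat)) :=
  let n := Msize B in let m := Msize D in
  [seq (q ^+ capM n m p.2 p.1, p.1)
   | p <- Wset B D & ~~ has (fun x => (x <= n)%N) (last [::] p.1)].

Definition M_dot (B D : seq (seq nat)) : lincomb R (seq (seq nat)) :=
  let n := Msize B in let m := Msize D in
  [seq (q ^+ (capM n m p.2 p.1).-1, p.1)
   | p <- Wset B D & has (fun x => (x <= n)%N) (last [::] p.1)
                      && has (inS p.2 m) (last [::] p.1)].

Definition M_prec (B D : seq (seq nat)) : lincomb R (seq (seq nat)) :=
  let n := Msize B in let m := Msize D in
  [seq (q ^+ capM n m p.2 p.1, p.1)
   | p <- Wset B D & ~~ has (inS p.2 m) (last [::] p.1)].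

Definition M_cop (B : seq (seq nat)) : lincomb R (seq (seq nat) * seq (seq nat)) :=
  [seq (1, (stdM (take i B), stdM (drop i B))) | i <- iota 0 (size B).+1].

End MMR.

Definition phi (f : seq nat) : seq (seq nat) := stdM (blocks_of (size f) f).

(* Main.v *)
Require Import Defs.
From HB Require Import structures.
From mathcomp Require Import all_boot all_order all_algebra.
From mathcomp Require Import zify.
Set Implicit Arguments. Unset Strict Implicit. Unset Printing Implicit Defensive.

(** Taking the fibers of a word identifies M-permutations with the surjective
    words having no two equal adjacent letters (Smirnov words), and under this
    identification [phi] is the operation [destutter] that deletes each letter
    equal to its predecessor.  Destuttering commutes with standardization and
    preserves the set of letters, hence maxima and numbers of common letters.

    A word [h] can be recovered from [stdw h] and [destutter h], and every pair
    of compatible values arises.  So, given [stdw h = f] and [stdw k = g], the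
    word [hk] amounts to a Smirnov word [v = destutter (hk)] together with the
    choice of whether [last h] and [head k] are equal: [destutter h] and
    [destutter k] are then a prefix and a suffix of [v] that overlap in one
    letter or not at all.  These are the two kinds of elements of [Wset], so the
    terms of each product in ST correspond bijectively to those in MMR. *)

(** * Destuttering and Smirnov words *)

Section Destutter.
Variable T : eqType.
Implicit Types (x y : T) (s h k v : seq T) (p : pred T).

Fixpoint destutter_from x s :=
  if s is y :: s' then
    if y == x then destutter_from x s' else y :: destutter_from y s'
  else [::].

Definition destutter s := if s is x :: s' then x :: destutter_from x s' else [::].

Definition smirnov s := sorted (fun x y => y != x) s.

Lemma destutter_from_cat x h k :
  destutter_from x (h ++ k) = destutter_from x h ++ destutter_from (last x h) k.
Proof.
elim: h x => //= y h IH x; case: eqP => [->|_]; first exact: IH.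
by rewrite IH.
Qed.

Lemma last_destutter (x0 : T) s : last x0 (destutter s) = last x0 s.
Proof.
case: s => //= x s.
by elim: s x => //= y s IH x; case: eqP => [->|_] /=; apply: IH.
Qed.

Lemma head_destutter (x0 : T) s : head x0 (destutter s) = head x0 s.
Proof. by case: s. Qed.

Lemma mem_destutter s : destutter s =i s.
Proof.
case: s => // x s z; rewrite /= !inE.
elim: s x => //= y s IH x; case: (y =P x) => [->|_]; last by rewrite !inE IH.
by rewrite IH inE; case: (z == x).
Qed.

Lemma size_destutter_gt0 s : (0 < size (destutter s)) = (0 < size s).
Proof. by case: s. Qed.

Lemma smirnov_destutter s : smirnov (destutter s).
Proof.
case: s => //= x s.
by elim: s x => //= y s IH x; case: ifP => //= ->; apply: IH.
Qed.

Lemma destutter_id s : smirnov s -> destutter s = s.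
Proof.
case: s => //= x s ps; congr (_ :: _).
elim: s x ps => //= y s IH x /andP[/negPf-> ps].
by rewrite IH.
Qed.

(** Destuttering remembers only the preceding letter, so the junction can affect [k] only through
    its first run. The boolean, read as a number, drops the letter of that run when it repeats the
    last letter of [h]. *)
Lemma destutter_cat (x0 : T) h k : 0 < size h -> 0 < size k ->
  destutter (h ++ k)
  = destutter h ++ drop (last x0 h == head x0 k) (destutter k).
Proof.
case: h => //= x h _; case: k => //= y k _.
by rewrite destutter_from_cat /= eq_sym; case: eqP => [->|_]; rewrite /= ?drop0.
Qed.

Lemma take_destutter_cat h k : 0 < size h -> 0 < size k ->
  take (size (destutter h)) (destutter (h ++ k)) = destutter h.
Proof.
by case: h => // x h h0 k0; rewrite (destutter_cat x) // take_size_cat.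
Qed.

(** If the junction letters agree, the copy of [destutter k] begins at the last letter of
    [destutter h], otherwise just after it. Before the [.-1], the offset is the 1-based starting
    position, which becomes the least element of [S] in [Wset]. *)
Lemma drop_destutter_cat (x0 : T) h k : 0 < size h -> 0 < size k ->
  drop (size (destutter h) + (last x0 h != head x0 k)).-1 (destutter (h ++ k))
  = destutter k.
Proof.
move=> h0 k0; rewrite (destutter_cat x0) //.
case: eqP => e /=; last by rewrite addn1 /= drop0 drop_size_cat.
have dh0 : 0 < size (destutter h) by rewrite size_destutter_gt0.
rewrite addn0 drop_cat ltn_predL dh0 (drop_nth x0) ?ltn_predL // prednK //.
rewrite drop_size nth_last last_destutter e -(head_destutter x0 k).
by case: (k) k0 => //= y k' _; rewrite drop0.
Qed.

(* [b] tells whether [h] and [k] are disjoint parts of [v] ([true]) or share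
   its [n]-th letter ([false]). *)
Lemma destutter_glue (x0 : T) v n m (b : bool) h k :
  smirnov v -> 0 < n -> 0 < m -> size v = (n + b).-1 + m ->
  destutter h = take n v -> destutter k = drop (n + b).-1 v ->
  destutter (h ++ k) = v /\ (last x0 h != head x0 k) = b.
Proof.
move=> sv n0 m0 szv eh ek.
have sn : n <= size v by rewrite szv; case: (b); lia.
have sd : (n + b).-1 < size v by rewrite szv; case: (b); lia.
have h0 : 0 < size h by rewrite -size_destutter_gt0 eh size_take_min; lia.
have k0 : 0 < size k by rewrite -size_destutter_gt0 ek size_drop; lia.
(* The letters compared are [v] at index [n.-1] and at index [(n + b).-1]: the same index if [b] is
   false, adjacent indices of a Smirnov word if [b] is true. *)
have eb : (last x0 h != head x0 k) = b.
  rewrite -last_destutter -head_destutter eh ek (drop_nth x0) //=.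
  rewrite -nth_last size_takel // nth_take; last by lia.
  case: b szv sd {ek} => szv sd; last by rewrite addn0 eqxx.
  rewrite addn1 /= eq_sym -{2}(prednK n0).
  rewrite addn1 /= in szv sd.
  have /sortedP - /(_ x0 n.-1) := sv.
  by rewrite prednK // => -> //.
split=> //; rewrite (destutter_cat x0) //.
rewrite -(negbK (last x0 h == _)) eb eh ek drop_drop -[RHS](cat_take_drop n).
by congr (_ ++ drop _ _); case: (b); lia.
Qed.

(** A deleted letter has an equal letter before it, and the filter keeps both or neither. This is
    what makes [phi] compatible with the coproduct. *)
Lemma destutter_filter p s :
  destutter (filter p (destutter s)) = destutter (filter p s).
Proof.
(* Two memories are needed: [x] is the last letter read, [y] the last letter that passed the filter.
   They coincide as soon as [x] passes. *)
have Hp x y s' : (p x -> x = y) ->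
    destutter_from y (filter p (destutter_from x s'))
    = destutter_from y (filter p s').
  elim: s' x y => //= z s' IH x y pxy.
  case: eqP => [->|_].
    by rewrite IH //; case: ifP => //= px; rewrite pxy // eqxx.
  rewrite /=; case: ifP => pz /=; last by apply: IH; rewrite pz.
  case: eqP => [->|_]; first by rewrite IH.
  by rewrite IH.
case: s => //= x s; case: ifP => /= px; first by rewrite Hp.
elim: s x px => //= z s IH x px; case: eqP => [->|_].
  by rewrite px IH.
by rewrite /=; case: ifP => pz /=; [rewrite Hp | apply: IH].
Qed.

End Destutter.

Lemma destutter_map (T U : eqType) (F : T -> U) (s : seq T) :
  {in s &, injective F} -> destutter (map F s) = map F (destutter s).
Proof.
case: s => //= x s inj; congr (_ :: _).
elim: s x inj => //= y s IH x inj.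
rewrite (inj_in_eq inj) ?inE ?eqxx ?orbT //.
case: eqP => [e|_]; rewrite /= IH //; apply: sub_in2 inj => z;
  rewrite !inE; by [case/orP=> ->; rewrite ?orbT | move=> ->; rewrite orbT].
Qed.

(** * Ranks, maxima and standardization of words *)

Definition rank (u : seq nat) (x : nat) : nat :=
  size (undup [seq y <- u | y <= x]).

Lemma stdwE u : stdw u = map (rank u) u.
Proof. by []. Qed.

Lemma size_stdw u : size (stdw u) = size u.
Proof. exact: size_map. Qed.

Lemma eq_rank u v : u =i v -> rank u =1 rank v.
Proof.
move=> e x; apply/perm_size/perm_undup => y.
by rewrite !mem_filter e.
Qed.

Lemma rank_index u cs c : sorted ltn cs -> cs =i u -> c \in cs ->
  rank u c = (index c cs).+1.
Proof.
move=> scs /eq_rank/(_ c) <-; rewrite /rank undup_id; last first.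
  by rewrite filter_uniq // (sorted_uniq ltn_trans ltnn).
rewrite size_filter.
elim: cs scs => //= x cs IH pcs; rewrite inE eq_sym.
have ax := order_path_min ltn_trans pcs.
case: eqP => [<-|/eqP ne] /=.
  rewrite leqnn (@eq_in_count _ _ pred0) ?count_pred0 // => y /(allP ax) /=.
  by rewrite ltnNge => /negPf.
move=> cin; rewrite (ltnW (allP ax _ cin)) IH //.
exact: path_sorted pcs.
Qed.

Definition letters (u : seq nat) : seq nat := sort leq (undup u).

Lemma letters_sorted u : sorted ltn (letters u).
Proof.
rewrite ltn_sorted_uniq_leq sort_uniq undup_uniq.
exact: sort_sorted leq_total _.
Qed.

Lemma mem_letters u : letters u =i u.
Proof. by move=> x; rewrite mem_sort mem_undup. Qed.

Lemma rank_inj u : {in u &, injective (rank u)}.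
Proof.
move=> x y; rewrite -(mem_letters u x) -(mem_letters u y) => xu yu.
rewrite !(rank_index (letters_sorted u) (mem_letters u)) // => -[e].
by rewrite -(nth_index 0 xu) e nth_index.
Qed.

Lemma map_rank u cs : sorted ltn cs -> cs =i u ->
  map (rank u) cs = iota 1 (size cs).
Proof.
move=> scs ecs; have ucs := sorted_uniq ltn_trans ltnn scs.
apply: (@eq_from_nth _ 0); rewrite size_map ?size_iota // => i i_lt.
by rewrite (nth_map 0) // nth_iota // (rank_index scs ecs) ?mem_nth ?index_uniq.
Qed.

Lemma maxw_ge u x : x \in u -> x <= maxw u.
Proof.
rewrite /maxw; elim: u => //= y u IH; rewrite inE leq_max => /orP[/eqP->|/IH->].
  by rewrite leqnn.
by rewrite orbT.
Qed.

Lemma maxw_mem u : 0 < size u -> maxw u \in u.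
Proof.
elim: u => //= x u IH _; case: u IH => [|y u] IH; first by rewrite /= maxn0 inE.
by rewrite inE; case: leqP => _; rewrite ?IH ?orbT ?eqxx.
Qed.

Lemma eq_maxw u v : u =i v -> maxw u = maxw v.
Proof.
have H a b : a =i b -> maxw a <= maxw b.
  case: a => // x a e; apply: maxw_ge; rewrite -e; exact: maxw_mem.
by move=> e; apply/eqP; rewrite eqn_leq !H.
Qed.

Lemma maxw_iota r : maxw (iota 1 r) = r.
Proof.
case: r => // r; apply/eqP; rewrite eqn_leq maxw_ge ?mem_iota //; last by lia.
by have := @maxw_mem (iota 1 r.+1) isT; rewrite mem_iota; lia.
Qed.

Lemma surjwP f : reflect (f =i iota 1 (maxw f)) (is_surjw f).
Proof.
rewrite /is_surjw; apply: (iffP andP) => [[/allP sf f0] x|e].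
  apply/idP/idP => [xf|/sf //]; rewrite mem_iota ltnS maxw_ge // andbT lt0n.
  by apply: contraNneq f0 => <-.
by split; [apply/allP => x; rewrite e | rewrite e mem_iota].
Qed.

Lemma surjw_iota f r : f =i iota 1 r -> is_surjw f /\ maxw f = r.
Proof.
move=> e; have m : maxw f = r by rewrite (eq_maxw e) maxw_iota.
by split=> //; apply/surjwP; rewrite m.
Qed.

Lemma eq_surjw u v : u =i v -> is_surjw u = is_surjw v.
Proof.
move=> e; apply/surjwP/surjwP => eu x; first by rewrite -e -(eq_maxw e).
by rewrite e (eq_maxw e).
Qed.

Lemma stdw_surj u : is_surjw (stdw u) /\ maxw (stdw u) = size (letters u).
Proof.
apply: surjw_iota => x; rewrite -(map_rank (letters_sorted u) (mem_letters u)).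
by rewrite stdwE; apply: eq_mem_map => y; rewrite mem_letters.
Qed.

(** The increasing list of letters is [iota 1 (maxw f)], and [map_rank] says that ranking fixes this
    list; its entry at index [x.-1] gives [rank f x = x]. *)
Lemma stdw_id f : is_surjw f -> stdw f = f.
Proof.
move/surjwP=> sf; rewrite stdwE -[RHS]map_id; apply/eq_in_map => x.
have so : sorted ltn (iota 1 (maxw f)) by exact: iota_ltn_sorted.
have eo : iota 1 (maxw f) =i f by move=> y; rewrite sf.
have := map_rank so eo; rewrite size_iota => e.
rewrite sf => xf; have := xf; rewrite mem_iota => xb.
have lt : x.-1 < size (iota 1 (maxw f)) by rewrite size_iota; lia.
have := congr1 (fun s => nth 0 s x.-1) e; rewrite (nth_map 0) //.
by rewrite size_iota in lt; rewrite nth_iota // add1n prednK //; lia.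
Qed.

(** The rank function depends only on the set of letters, which destuttering keeps, and it is
    injective there, so it creates no new repetitions. *)
Lemma stdw_destutter u : stdw (destutter u) = destutter (stdw u).
Proof.
rewrite !stdwE (destutter_map (@rank_inj u)); apply: eq_map.
exact/eq_rank/mem_destutter.
Qed.

Lemma smirnov_stdw u : smirnov u -> smirnov (stdw u).
Proof. by move/destutter_id <-; rewrite stdw_destutter smirnov_destutter. Qed.

Lemma surjw_destutter f : is_surjw (destutter f) = is_surjw f.
Proof. exact/eq_surjw/mem_destutter. Qed.

Lemma maxw_destutter f : maxw (destutter f) = maxw f.
Proof. exact/eq_maxw/mem_destutter. Qed.

(** Equal destuttered words have the same letters, hence the same rank function; being injective on
    these letters, it can be cancelled. *)
Lemma stdw_destutter_inj u v :
  destutter u = destutter v -> stdw u = stdw v -> u = v.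
Proof.
move=> ed; have e : u =i v by move=> x; rewrite -mem_destutter ed mem_destutter.
rewrite !stdwE -(eq_map (eq_rank e)).
apply: (inj_in_map (@rank_inj u)); apply/allP => x //=.
by rewrite e.
Qed.

(* The witness applies to [f] the inverse of [rank u]. *)
Lemma unstutter u f : stdw u = destutter f ->
  exists2 h, stdw h = f & destutter h = u.
Proof.
move=> e; pose psi c := nth 0 u (index c (stdw u)).
have psiK x : x \in u -> psi (rank u x) = x.
  move=> xu; rewrite /psi stdwE.
  have lt : index (rank u x) (map (rank u) u) < size u.
    by rewrite -(size_map (rank u)) index_mem map_f.
  apply: (@rank_inj u); rewrite ?mem_nth //.
  by rewrite -(nth_map 0 0) // nth_index // map_f.
have rankK c : c \in f -> rank u (psi c) = c.
  by rewrite -mem_destutter -e => /mapP[x xu ->]; rewrite psiK.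
have dh : destutter (map psi f) = u.
  rewrite destutter_map -?e; last first.
    by move=> x y xf yf exy; rewrite -(rankK x) // exy rankK.
  by rewrite stdwE -map_comp -[RHS]map_id; apply/eq_in_map => x /psiK.
exists (map psi f) => //; rewrite stdwE -map_comp -[RHS]map_id.
apply/eq_in_map => c /rankK /= {2}<-; apply: eq_rank => x.
by rewrite -mem_destutter dh.
Qed.

(** * Blocks as fibers: restriction, standardization and [phi] *)

(** A common form for [blocks_of] and what is derived from it: restricting to a subset shrinks [s],
    and selecting blocks or deleting empty ones shrinks [cs]. *)
Definition fibers (s : seq nat) (ell : nat -> nat) (cs : seq nat) :=
  [seq [seq i <- s | ell i == c] | c <- cs].

Definition letter (w : seq nat) (i : nat) : nat := nth 0 w i.-1.

Definition blocks (w : seq nat) : seq (seq nat) := blocks_of (size w) w.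

Lemma blocksE w :
  blocks w = fibers (iota 1 (size w)) (letter w) (iota 1 (maxw w)).
Proof. by []. Qed.

Lemma has_fiber (s : seq nat) (ell : nat -> nat) c (J : pred nat) :
  has J [seq i <- s | ell i == c] = (c \in map ell [seq i <- s | J i]).
Proof.
apply/hasP/mapP => [[i]|[i]]; rewrite mem_filter.
  by case/andP=> /eqP <- si Ji; exists i; rewrite // mem_filter Ji.
by case/andP=> Ji si ->; exists i; rewrite // mem_filter eqxx.
Qed.

Lemma fibers_neq0 (s : seq nat) (ell : nat -> nat) cs :
  [seq b <- fibers s ell cs | b != [::]]
  = fibers s ell [seq c <- cs | c \in map ell s].
Proof.
rewrite /fibers filter_map; congr map; apply: eq_filter => c /=.
by rewrite -has_filter -has_pred1 has_map; apply: eq_has => i /=.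
Qed.

Lemma restrict_fibers J (s : seq nat) (ell : nat -> nat) cs :
  restrictM J (fibers s ell cs)
  = [seq b <- fibers [seq i <- s | J i] ell cs | b != [::]].
Proof.
rewrite /restrictM /fibers -map_comp; congr filter; apply: eq_map => c /=.
by rewrite -!filter_predI; apply: eq_filter => i /=; rewrite andbC.
Qed.

Lemma filter_letters u cs : sorted ltn cs -> {subset u <= cs} ->
  [seq c <- cs | c \in u] = letters u.
Proof.
move=> scs sub; apply: (irr_sorted_eq ltn_trans ltnn).
- exact: sorted_filter ltn_trans _ _ scs.
- exact: letters_sorted.
move=> x; rewrite mem_filter mem_letters.
by apply/andP/idP => [[]|xu] //; split=> //; apply: sub.
Qed.

Lemma flatten_fibers (s : seq nat) (ell : nat -> nat) cs : uniq cs -> {subset map ell s <= cs} ->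
  perm_eq (flatten (fibers s ell cs)) s.
Proof.
elim: cs s => [|c cs IH] s /=.
  by case: s => // x s _ /(_ (ell x)); rewrite inE eqxx => /(_ isT).
case/andP=> cncs ucs sub.
(* Since [c] is not in [cs], elements labelled [c] lie in none of the remaining fibers. *)
have -> : fibers s ell cs = fibers [seq i <- s | ell i != c] ell cs.
  apply/eq_in_map => d dcs; rewrite -filter_predI; apply: eq_filter => i /=.
  by case: eqP => //= ->; apply/esym; apply: contraNneq cncs => <-.
apply: perm_trans (perm_cat (perm_refl _) (IH _ ucs _)) _.
  move=> d /mapP[i]; rewrite mem_filter => /andP[/negPf ne si] ->.
  by have := sub _ (map_f ell si); rewrite inE ne.
by rewrite perm_filterC.
Qed.

(* The left-hand side is the deletion step inside [stdM]. *)
Lemma destutterE (w : seq nat) :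
  [seq nth 0 w i | i <- iota 0 (size w)
     & (i == 0) || (nth 0 w i != nth 0 w i.-1)] = destutter w.
Proof.
case: w => //= x t; congr (_ :: _).
have -> : iota 1 (size t) = map S (iota 0 (size t)) by rewrite -(iotaDl 1 0).
rewrite filter_map -map_comp /=.
elim: t x => //= y t IH x.
rewrite /preim /=; have := IH y.
have -> : iota 1 (size t) = map S (iota 0 (size t)) by rewrite -(iotaDl 1 0).
case: (y =P x) => [->|_] /= <-; rewrite filter_map -map_comp //=.
Qed.

(** The sort inside [stdM] returns [s] itself, and the index of the nonempty block containing [i] is
    the position of [ell i] among the letters. So the word built by [stdM] is the standardized label
    word, which is then destuttered. *)
Lemma stdM_fibers (s : seq nat) (ell : nat -> nat) cs : sorted ltn s -> sorted ltn cs ->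
  {subset map ell s <= cs} ->
  stdM (fibers s ell cs) = blocks (destutter (stdw (map ell s))).
Proof.
move=> ss scs sub; rewrite /stdM fibers_neq0 filter_letters //.
set u := map ell s; set ls := letters u.
have sls : sorted ltn ls := letters_sorted u.
have els : ls =i u := mem_letters u.
have -> : sort leq (flatten (fibers s ell ls)) = s.
  have pf : perm_eq (flatten (fibers s ell ls)) s.
    apply: flatten_fibers; first exact: sorted_uniq ltn_trans ltnn _ sls.
    by move=> x; rewrite els.
  have /perm_sortP -> := pf; [|exact: leq_total|exact: leq_trans|exact: anti_leq].
  apply: (sorted_sort leq_trans).
  by move: ss; rewrite ltn_sorted_uniq_leq => /andP[].
set w := map _ s.
(* [stdM] numbers blocks from 0, whereas ranks start at 1. *)
have ew : stdw u = map S w.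
  rewrite stdwE -!map_comp; apply/eq_in_map => i si /=.
  have ui : ell i \in ls by rewrite els map_f.
  rewrite (rank_index sls els ui) /fibers find_map; congr _.+1.
  by apply: eq_find => c /=; rewrite mem_filter si andbT eq_sym.
have [_] := stdw_surj u.
rewrite destutterE ew (@destutter_map _ _ S); last by move=> x y _ _ [].
rewrite /blocks /blocks_of => mx.
have -> : maxw (map S (destutter w)) = size ls.
  rewrite -mx; apply: eq_maxw => x; apply: eq_mem_map => y.
  exact: mem_destutter.
rewrite !size_map (iotaDl 1 0 (size ls)) -map_comp; apply: eq_map => c /=.
rewrite (iotaDl 1 0 (size _)) filter_map; congr map.
apply: eq_in_filter => i; rewrite mem_iota add0n => /andP[_ lt] /=.
by rewrite (nth_map 0).
Qed.

Lemma map_letter v lo m : 0 < lo -> lo.-1 + m <= size v ->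
  map (letter v) (iota lo m) = take m (drop lo.-1 v).
Proof.
move=> lo0 le; apply: (@eq_from_nth _ 0) => [|i].
  by rewrite size_map size_iota size_takel // size_drop; lia.
rewrite size_map size_iota => lt.
rewrite (nth_map 0) ?size_iota // nth_iota // nth_take // nth_drop /letter.
by congr nth; lia.
Qed.

Lemma map_letter1 v : map (letter v) (iota 1 (size v)) = v.
Proof. by rewrite map_letter //= drop0 take_size. Qed.

Lemma filter_iota_leq1 n N : n <= N ->
  [seq i <- iota 1 N | i <= n] = iota 1 n.
Proof.
move=> le; apply: (irr_sorted_eq ltn_trans ltnn).
- by apply: sorted_filter ltn_trans _ _ _; exact: iota_ltn_sorted.
- exact: iota_ltn_sorted.
by move=> i; rewrite mem_filter !mem_iota; lia.
Qed.

Lemma filter_iota_inS lo m N : 0 < lo -> lo.-1 + m <= N ->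
  [seq i <- iota 1 N | inS lo m i] = iota lo m.
Proof.
move=> lo0 le; apply: (irr_sorted_eq ltn_trans ltnn).
- by apply: sorted_filter ltn_trans _ _ _; exact: iota_ltn_sorted.
- exact: iota_ltn_sorted.
by move=> i; rewrite mem_filter !mem_iota /inS; lia.
Qed.

(** An initial segment needs no renumbering of positions; deleting the empty blocks closes the gaps
    among the letters, which is standardization of the prefix. *)
Lemma restrict_blocks_take v n : is_surjw v -> n <= size v ->
  restrictM (fun x => x <= n) (blocks v) = blocks (stdw (take n v)).
Proof.
move=> /surjwP sv le; rewrite blocksE restrict_fibers filter_iota_leq1 //.
have eu : map (letter v) (iota 1 n) = take n v by rewrite map_letter // drop0.
rewrite fibers_neq0 eu filter_letters; first last.
- by move=> x /mem_take; rewrite sv.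
- exact: iota_ltn_sorted.
set u := take n v; have [_ mu] := stdw_surj u.
rewrite blocksE mu size_stdw -(map_rank (letters_sorted u) (mem_letters u)).
have -> : size u = n by rewrite size_takel.
rewrite /fibers -map_comp; apply/eq_in_map => c /=; rewrite mem_letters => cu.
apply: eq_in_filter => i; rewrite mem_iota => ib.
have lt : i.-1 < size u by rewrite size_takel //; lia.
have -> : letter v i = letter u i by rewrite /letter nth_take //; lia.
rewrite /letter stdwE (nth_map 0) // (inj_in_eq (@rank_inj u)) //.
exact: mem_nth.
Qed.

Lemma stdM_neq0 C : stdM [seq b <- C | b != [::]] = stdM C.
Proof. by rewrite /stdM filter_id. Qed.

Lemma stdM_restrict_blocks v lo m : is_surjw v -> 0 < lo ->
  size v = lo.-1 + m ->
  stdM (restrictM (inS lo m) (blocks v)) = blocks (destutter (stdw (drop lo.-1 v))).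
Proof.
move=> /surjwP sv lo0 sz; rewrite blocksE restrict_fibers filter_iota_inS ?sz //.
have eu : map (letter v) (iota lo m) = drop lo.-1 v.
  by rewrite map_letter ?sz // take_oversize // size_drop; lia.
rewrite stdM_neq0 stdM_fibers ?eu //; try exact: iota_ltn_sorted.
by move=> x /mem_drop; rewrite sv.
Qed.

(** With no letter 0, every position lies in a fiber over [iota 1 (maxw f)]; missing values give
    empty blocks, which [stdM] removes. The coproduct factors, including the empty word, are
    covered. *)
Lemma phi_blocks f : 0 \notin f -> phi f = blocks (destutter (stdw f)).
Proof.
move=> f0; rewrite /phi -/(blocks f) blocksE stdM_fibers ?map_letter1 //.
- exact: iota_ltn_sorted.
- exact: iota_ltn_sorted.
move=> x xf; rewrite mem_iota ltnS maxw_ge // andbT lt0n.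
by apply: contraNneq f0 => <-.
Qed.

Lemma phi_surjw f : is_surjw f -> phi f = blocks (destutter f).
Proof.
by move=> sf; rewrite phi_blocks ?stdw_id //; case/andP: sf.
Qed.

Lemma size_blocks w : size (blocks w) = maxw w.
Proof. by rewrite size_map size_iota. Qed.

Lemma flatten_blocks w : is_surjw w ->
  perm_eq (flatten (blocks w)) (iota 1 (size w)).
Proof.
move/surjwP=> sw; apply: flatten_fibers; first exact: iota_uniq.
by rewrite map_letter1 => x; rewrite sw.
Qed.

Lemma Msize_blocks w : is_surjw w -> Msize (blocks w) = size w.
Proof. by move/flatten_blocks/perm_size; rewrite size_iota. Qed.

Lemma nth_blocks w c : 0 < c <= maxw w ->
  nth [::] (blocks w) c.-1 = [seq i <- iota 1 (size w) | letter w i == c].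
Proof.
move=> cb; rewrite (nth_map 0) ?size_iota; last by lia.
by rewrite nth_iota ?add1n ?prednK //; lia.
Qed.

(** The numbers of elements and of blocks give the length and the maximum, and the block containing
    a position reveals its letter. *)
Lemma blocks_inj : {in is_surjw &, injective blocks}.
Proof.
move=> v w sv sw e; have szE : size v = size w.
  by rewrite -(Msize_blocks sv) e Msize_blocks.
have mxE : maxw v = maxw w by rewrite -!size_blocks e.
apply: (@eq_from_nth _ 0) => // i lt; set c := nth 0 v i.
have cb : 0 < c <= maxw v.
  have /surjwP - /(_ c) := sv; rewrite mem_nth // mem_iota => /esym; lia.
have : i.+1 \in nth [::] (blocks v) c.-1.
  by rewrite nth_blocks // mem_filter /letter eqxx mem_iota; lia.
rewrite e nth_blocks -?mxE // mem_filter /letter => /andP[/eqP] //.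
Qed.

(** The fibers of a surjective word always form an ordered set partition; the remaining condition
    forbids equal letters at positions [i] and [i.+1]. *)
Lemma Mperm_blocks v : is_surjw v -> is_Mperm (size v) (blocks v) = smirnov v.
Proof.
move=> sv; rewrite /is_Mperm flatten_blocks //=.
have -> : all (fun b => (b != [::]) && sorted ltn b) (blocks v).
  apply/allP => b /mapP[c cb ->]; rewrite -has_filter; apply/andP; split.
    rewrite (eq_has (a2 := preim (letter v) (pred1 c))) // -has_map.
    by rewrite map_letter1 has_pred1; have /surjwP -> := sv.
  by apply: sorted_filter ltn_trans _ _ _; exact: iota_ltn_sorted.
apply/allP/(sortedP 0) => [H i lt|H b /mapP[c cb ->]]; last first.
  apply/allP => i; rewrite !mem_filter !mem_iota => /andP[/eqP ei ib].
  apply/negP=> /andP[/eqP ej jb].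
  have i0 : 0 < i by lia.
  have lt : i < size v by lia.
  by have := H i.-1; rewrite prednK // => /(_ lt); rewrite ei ej eqxx.
have vi : nth 0 v i \in iota 1 (maxw v).
  by have /surjwP <- := sv; rewrite mem_nth // ltnW.
have ib : i.+1 \in [seq j <- iota 1 (size v) | nth 0 v j.-1 == nth 0 v i].
  by rewrite mem_filter mem_iota /= eqxx; lia.
have /allP/(_ _ ib) := H _ (map_f _ vi).
rewrite mem_filter mem_iota /= negb_and => /orP[//|].
by rewrite !ltnS; lia.
Qed.

(** * Enumeration of surjective words and M-permutations *)

Lemma mem_allseqs L vals w :
  (w \in allseqs L vals) = (size w == L) && all (fun x => x \in vals) w.
Proof.
elim: L w => [|L IH] [|x w] //=.
  by apply/negbTE/negP => /allpairsP[[y s] [_ _]].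
apply/allpairsP/idP => [[[y s] /= [yv]]|].
  by rewrite IH => /andP[/eqP <- sv] [-> ->]; rewrite eqxx yv.
case/and3P=> sw xv wv; exists (x, w); split=> //=.
by rewrite IH wv andbT.
Qed.

Lemma allseqs_uniq L vals : uniq vals -> uniq (allseqs L vals).
Proof.
move=> uv; elim: L => //= L IH; apply: allpairs_uniq => //.
by move=> [x s] [y t] _ _ [-> ->].
Qed.

(** A surjective word contains [maxw w] distinct letters, so its letters are bounded by its length
    and the enumeration misses none. *)
Lemma mem_surjwords L w :
  (w \in surjwords L) = (size w == L) && is_surjw w.
Proof.
rewrite mem_filter mem_allseqs andbC -andbA; case: eqP => //= <-.
case sw: (is_surjw w); rewrite ?andbF ?andbT //.
apply/allP => x; have /surjwP sw' := sw; rewrite sw' !mem_iota.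
have := uniq_leq_size (iota_uniq 1 (maxw w)) (s2 := w).
rewrite size_iota => le; have {}le : maxw w <= size w.
  by apply: le => y; rewrite sw'.
by case/andP=> -> lt; apply: leq_trans lt _; rewrite add1n ltnS.
Qed.

Lemma surjwords_uniq L : uniq (surjwords L).
Proof. by rewrite filter_uniq // allseqs_uniq // iota_uniq. Qed.

Lemma MpermsE N :
  Mperms N = [seq blocks w | w <- surjwords N & smirnov w].
Proof.
rewrite /Mperms.
have -> : [seq w <- surjwords N | is_Mperm N (blocks_of N w)]
        = [seq w <- surjwords N | smirnov w].
  apply: eq_in_filter => w; rewrite mem_surjwords => /andP[/eqP <- sw].
  exact: Mperm_blocks.
apply/eq_in_map => w; rewrite mem_filter mem_surjwords /blocks.
by case/and3P=> _ /eqP->.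
Qed.

Lemma MpermsP N W : reflect
  (exists v, [/\ is_surjw v, smirnov v, size v = N & W = blocks v])
  (W \in Mperms N).
Proof.
rewrite MpermsE; apply: (iffP mapP) => [[v]|[v [sv mv sz ->]]].
  rewrite mem_filter mem_surjwords => /and3P[mv /eqP sz sv] ->.
  by exists v.
by exists v; rewrite // mem_filter mem_surjwords sz eqxx mv.
Qed.

Lemma Mperms_uniq N : uniq (Mperms N).
Proof.
rewrite MpermsE map_inj_in_uniq; first exact/filter_uniq/surjwords_uniq.
move=> v w.
rewrite mem_filter mem_surjwords => /and3P[_ _ sv].
rewrite mem_filter mem_surjwords => /and3P[_ _ sw].
exact: blocks_inj.
Qed.

(** * Common letters, last blocks and the index set of the products *)

Lemma eq_capw h k h' k' : h =i h' -> k =i k' -> capw h k = capw h' k'.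
Proof.
move=> eh ek; apply/perm_size/perm_undup => x.
by rewrite !mem_filter eh ek.
Qed.

Lemma has_leq_block v n c : n <= size v ->
  has (fun x => x <= n) [seq i <- iota 1 (size v) | letter v i == c]
  = (c \in take n v).
Proof.
by move=> le; rewrite has_fiber filter_iota_leq1 // map_letter // drop0.
Qed.

Lemma has_inS_block v lo m c : 0 < lo -> size v = lo.-1 + m ->
  has (inS lo m) [seq i <- iota 1 (size v) | letter v i == c]
  = (c \in drop lo.-1 v).
Proof.
move=> lo0 sz; rewrite has_fiber filter_iota_inS ?sz // map_letter ?sz //.
by rewrite take_oversize // size_drop; lia.
Qed.

(** The block of a letter meets [[n]] iff the letter occurs in the prefix, and meets [S] iff it
    occurs in the suffix. *)
Lemma capM_blocks v n m lo : is_surjw v -> 0 < lo -> n <= size v ->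
  size v = lo.-1 + m ->
  capM n m lo (blocks v) = capw (take n v) (drop lo.-1 v).
Proof.
move=> /surjwP sv lo0 le sz; rewrite /capM blocksE /fibers count_map.
rewrite (@eq_count _ _ (fun c => (c \in drop lo.-1 v) && (c \in take n v)));
  last first.
  by move=> c /=; rewrite has_leq_block // has_inS_block // andbC.
rewrite -size_filter /capw; apply/perm_size/uniq_perm.
- by rewrite filter_uniq // iota_uniq.
- exact: undup_uniq.
move=> c; rewrite mem_undup !mem_filter -sv.
by case ch: (c \in take n v); rewrite ?andbF // andbT (mem_take ch) andbT.
Qed.

Lemma last_blocks v : is_surjw v -> 0 < size v ->
  last [::] (blocks v) = [seq i <- iota 1 (size v) | letter v i == maxw v].
Proof.
move=> /surjwP sv v0; have := maxw_mem v0; rewrite sv mem_iota => mb.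
by rewrite -nth_last size_blocks nth_blocks //; lia.
Qed.

(** The maximum of [v] is the larger of the two maxima. This turns conditions on the last block into
    comparisons of maxima. *)
Lemma maxw_cover v h k : v =i h ++ k -> 0 < size h -> 0 < size k ->
  ((maxw v \in h) = (maxw k <= maxw h)) * ((maxw v \in k) = (maxw h <= maxw k)).
Proof.
have H a h' k' : a =i h' ++ k' -> 0 < size h' -> 0 < size k' ->
    (maxw a \in h') = (maxw k' <= maxw h').
  move=> e h0 k0; apply/idP/idP => [/maxw_ge|le].
    by apply: leq_trans; apply: maxw_ge; rewrite e mem_cat maxw_mem ?orbT.
  suff -> : maxw a = maxw h' by exact: maxw_mem.
  apply/eqP; rewrite eqn_leq [maxw h' <= _]maxw_ge ?andbT; last first.
    by rewrite e mem_cat maxw_mem.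
  have a0 : 0 < size a.
    by have := e (maxw h'); rewrite mem_cat maxw_mem //; case: (a).
  have := maxw_mem a0; rewrite e mem_cat => /orP[/maxw_ge //|/maxw_ge].
  by move/leq_trans; apply.
move=> e h0 k0; rewrite (H _ _ _ e) // (H v k h) // => x.
by rewrite e !mem_cat orbC.
Qed.

(** Treats both kinds of pairs uniformly: [b] is true for disjoint parts and false for parts sharing
    one position, and [size f + b] is the least element of [S]. A suffix of a Smirnov word is
    Smirnov, so standardizing the restriction to [S] deletes nothing. *)
Lemma WsetP f g p : is_surjw f -> is_surjw g -> smirnov g ->
  0 < size f -> 0 < size g ->
  reflect
    (exists v (b : bool),
       [/\ is_surjw v, smirnov v, size v = (size f + b).-1 + size g &
        [/\ stdw (take (size f) v) = f, stdw (drop (size f + b).-1 v) = g &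
            p = (blocks v, size f + b)]])
    (p \in Wset (blocks f) (blocks g)).
Proof.
move=> sf sg mg f0 g0; rewrite /Wset !Msize_blocks //.
set n := size f; set m := size g.
pose cond W lo := (restrictM (fun x => x <= n) W == blocks f)
                   && (stdM (restrictM (inS lo m) W) == blocks g).
have condE v (b : bool) : is_surjw v -> smirnov v -> size v = (n + b).-1 + m ->
    cond (blocks v) (n + b) =
    (stdw (take n v) == f) && (stdw (drop (n + b).-1 v) == g).
  move=> sv mv sz; rewrite /cond restrict_blocks_take //; last first.
    by rewrite sz; case: (b); lia.
  rewrite stdM_restrict_blocks //; last by lia.
  rewrite destutter_id; last by apply/smirnov_stdw/drop_sorted.
  by rewrite !(inj_in_eq blocks_inj) //; case: (stdw_surj (take n v));
    case: (stdw_surj (drop (n + b).-1 v)).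
have aux (b : bool) N : N = (n + b).-1 + m -> reflect
    (exists v, [/\ is_surjw v, smirnov v, size v = (n + b).-1 + m &
        [/\ stdw (take n v) = f, stdw (drop (n + b).-1 v) = g &
            p = (blocks v, n + b)]])
    (p \in [seq (W, n + b) | W <- Mperms N & cond W (n + b)]).
  move=> eN; apply: (iffP mapP) => [[W]|[v [sv mv sz [eh ek ->]]]].
    rewrite mem_filter => /andP[cW /MpermsP[v [sv mv sz eW]]] ->.
    rewrite eN in sz; move: cW; rewrite eW condE // => /andP[/eqP eh /eqP ek].
    by exists v.
  exists (blocks v); rewrite // mem_filter condE // eh ek !eqxx /=.
  by apply/MpermsP; exists v; rewrite eN.
(* The least elements [n.+1] and [n] are rewritten as [n + true] and [n + false], so that [aux]
   applies to both halves of [Wset]. *)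
pose part (b : bool) N := [seq (W, n + b) | W <- Mperms N & cond W (n + b)].
have E1 : [seq (W, n.+1) | W <- Mperms (n + m) & cond W n.+1] = part true (n + m).
  by rewrite /part addn1.
have E2 : [seq (W, n) | W <- Mperms (n + m).-1 & cond W n] = part false (n + m).-1.
  by rewrite /part addn0.
rewrite [X in reflect _ X](_ : _ = (p \in part true (n + m))
                                   || (p \in part false (n + m).-1)); last first.
  by rewrite -E1 -E2 mem_cat.
have e1 : n + m = (n + true).-1 + m by rewrite addn1.
have e2 : (n + m).-1 = (n + false).-1 + m by lia.
apply: (iffP orP) => [[/(aux _ _ e1)[v H]|/(aux _ _ e2)[v H]]|[v [[] H]]].
- by exists v, true.
- by exists v, false.
- by left; apply/(aux _ _ e1); exists v.
- by right; apply/(aux _ _ e2); exists v.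
Qed.

Lemma Wset_uniq B D : uniq (Wset B D).
Proof.
rewrite /Wset cat_uniq; apply/and3P; split.
- by rewrite map_inj_uniq; [exact/filter_uniq/Mperms_uniq | move=> x y []].
- apply/hasPn => _ /mapP[W _ ->]; apply/negP => /mapP[W' _ []].
  by move=> _ /eqP; rewrite ltn_eqF.
by rewrite map_inj_uniq; [exact/filter_uniq/Mperms_uniq | move=> x y []].
Qed.

(** * Surjectivity of [phi] *)

Lemma find_block (B : seq (seq nat)) c i : uniq (flatten B) ->
  i \in nth [::] B c -> find (fun b => i \in b) B = c.
Proof.
elim: B c => [|b B IH] [|c] //=; first by move=> _ ->.
rewrite cat_uniq => /and3P[_ /hasPn dis uB] ic.
have cB : c < size B by rewrite ltnNge; apply: contraL ic => /(nth_default _) ->.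
rewrite (negPf (dis i _)) ?(IH c) //.
by apply/flattenP; exists (nth [::] B c) => //; rewrite mem_nth.
Qed.

(** The word sends [i] to the 1-based index of its block. Nonempty blocks make it surjective, and
    sortedness upgrades equality of blocks as sets to equality as lists. *)
Lemma Mperm_word n B : is_Mperm n B ->
  exists f, [/\ is_surjw f, size f = n & blocks f = B].
Proof.
case/and3P=> /allP nonempty_sorted perm_B _.
have uB : uniq (flatten B) by rewrite (perm_uniq perm_B) iota_uniq.
pose block_index i := find (fun b => i \in b) B.
pose f := [seq (block_index i).+1 | i <- iota 1 n].
have sz : size f = n by rewrite size_map size_iota.
have in_blockE c i : c < size B ->
    (i \in nth [::] B c) = (i \in iota 1 n) && (block_index i == c).
  move=> cB; apply/idP/andP => [ic|[]].
    split; last by rewrite /block_index (find_block uB ic).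
    rewrite -(perm_mem perm_B); apply/flattenP.
    by exists (nth [::] B c) => //; rewrite mem_nth.
  rewrite -(perm_mem perm_B) => /flattenP[b bB ib] /eqP <-.
  have hi : has (fun b => i \in b) B by apply/hasP; exists b.
  exact: (nth_find [::] hi).
have [sf mf] : is_surjw f /\ maxw f = size B.
  apply: surjw_iota => x; rewrite mem_iota; apply/mapP/idP => [[i iB ->]|xB].
    move: iB; rewrite -(perm_mem perm_B) => /flattenP[b bB ib].
    have : block_index i < size B by rewrite -has_find; apply/hasP; exists b.
    lia.
  have lt : x.-1 < size B by lia.
  have /nonempty_sorted/andP[] := mem_nth [::] lt.
  case eb: (nth _ _ _) => [|i b] // _ _.
  have := in_blockE _ i lt; rewrite eb mem_head => /esym/andP[iN /eqP ei].
  by exists i => //; rewrite ei prednK //; lia.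
exists f; split=> //; apply: (@eq_from_nth _ [::]) => [|c].
  by rewrite size_blocks.
rewrite size_blocks mf => cB.
have -> : nth [::] (blocks f) c = nth [::] (blocks f) c.+1.-1 by [].
rewrite nth_blocks ?mf //; apply: (irr_sorted_eq ltn_trans ltnn).
- by apply: sorted_filter ltn_trans _ _ _; exact: iota_ltn_sorted.
- by have /nonempty_sorted/andP[] := mem_nth [::] cB.
move=> i; rewrite mem_filter in_blockE // sz andbC.
case iN: (i \in iota 1 n) => //=; move: iN; rewrite mem_iota => iN.
rewrite /letter (nth_map 0) ?size_iota; last by lia.
by rewrite nth_iota; [rewrite add1n prednK ?eqSS //; lia | lia].
Qed.

(** The word of an M-permutation is Smirnov, hence fixed by destuttering, and so is itself a
    preimage. *)
Lemma phi_onto n B : is_Mperm n B ->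
  exists f, [/\ is_surjw f, size f = n & phi f = B].
Proof.
move=> pB; have [f [sf sz eB]] := Mperm_word pB.
exists f; split=> //; rewrite phi_surjw // destutter_id //.
by rewrite -Mperm_blocks // eB sz.
Qed.

(** * Compatibility with the coproduct *)

(** Choosing the blocks whose label satisfies [p] amounts to choosing the positions whose letter
    does. It serves the first [j] blocks and the remaining ones. *)
Lemma stdM_subblocks f (p : pred nat) cs : sorted ltn cs -> is_surjw f ->
  (forall c, (c \in cs) = (c \in iota 1 (maxw f)) && p c) ->
  stdM (fibers (iota 1 (size f)) (letter f) cs)
  = blocks (stdw (destutter (filter p f))).
Proof.
move=> scs /surjwP sf ecs.
have -> : fibers (iota 1 (size f)) (letter f) cs
  = fibers [seq i <- iota 1 (size f) | p (letter f i)] (letter f) cs.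
  apply/eq_in_map => c; rewrite ecs => /andP[_ pc].
  rewrite -filter_predI; apply: eq_filter => i /=.
  by case: eqP => // ->; rewrite pc.
have eu : map (letter f) [seq i <- iota 1 (size f) | p (letter f i)] = filter p f.
  by rewrite -(filter_map (letter f)) map_letter1.
rewrite stdM_fibers // ?eu ?stdw_destutter //.
- by apply: sorted_filter ltn_trans _ _ _; exact: iota_ltn_sorted.
- by move=> c; rewrite mem_filter ecs sf => /andP[-> ->].
Qed.

(** Destuttering keeps the maximum, so both sums have the same index range, and they agree term by
    term because filtering commutes with destuttering up to a final destuttering. *)
Lemma phi_cop (R : fieldType) f : is_surjw f ->
  lc_map (fun p => (phi p.1, phi p.2)) (ST_cop R f) = M_cop R (phi f).
Proof.
move=> sf; have sd : is_surjw (destutter f) by rewrite surjw_destutter.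
rewrite phi_surjw // /M_cop /ST_cop /lc_map -map_comp size_blocks maxw_destutter.
apply/eq_in_map => j; rewrite mem_iota add0n => jb /=.
have f0 p : 0 \notin filter p f.
  by case/andP: sf => _; apply: contra; rewrite mem_filter => /andP[].
have s0 : 0 \notin stdw [seq x <- f | j < x].
  by have [/andP[]] := stdw_surj [seq x <- f | j < x].
rewrite (phi_blocks (f0 _)) (phi_blocks s0).
(* The right factor has been standardized twice, once by the coproduct and once by [phi]; the second
   time changes nothing. *)
rewrite (stdw_id (proj1 (stdw_surj _))) -!stdw_destutter.
rewrite -!(destutter_filter _ f).
rewrite blocksE /fibers -map_take -map_drop take_iota drop_iota.
rewrite (@stdM_subblocks _ (fun x => x <= j)) ?iota_ltn_sorted //; last first.
  by move=> c; rewrite !mem_iota maxw_destutter; lia.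
rewrite (@stdM_subblocks _ (fun x => j < x)) ?iota_ltn_sorted //.
by move=> c; rewrite !mem_iota maxw_destutter; lia.
Qed.

(** * Compatibility with the three products *)

Lemma perm_lc_eq (R : nmodType) (T : eqType) (x y : lincomb R T) : perm_eq x y -> lc_eq x y.
Proof. by move=> e t; apply: perm_big. Qed.

(** One bijection serves all three products: [e] is the weight as a function of the overlap, and [P]
    and [Q] are corresponding conditions on maxima and on the last block. Weights and conditions see
    only sets of letters, which destuttering preserves. *)
Lemma lc_eq_products (R : fieldType) (e : nat -> R) (P : seq nat -> seq nat -> bool)
    (Q : seq (seq nat) * nat -> bool) f g :
  is_surjw f -> 0 < size f -> is_surjw g -> 0 < size g ->
  (forall h k h' k', h =i h' -> k =i k' -> P h k = P h' k') ->
  (forall v lo, is_surjw v -> 0 < lo <= (Msize (phi f)).+1 ->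
     Msize (phi f) <= size v -> size v = lo.-1 + Msize (phi g) ->
     Q (blocks v, lo) = P (take (Msize (phi f)) v) (drop lo.-1 v)) ->
  lc_eq
    (lc_map phi
      [seq (e (capw (take (size f) w) (drop (size f) w)), w)
        | w <- surjwords (size f + size g)
        & [&& stdw (take (size f) w) == f, stdw (drop (size f) w) == g
            & P (take (size f) w) (drop (size f) w)]])
    [seq (e (capM (Msize (phi f)) (Msize (phi g)) p.2 p.1), p.1)
      | p <- Wset (phi f) (phi g) & Q p].
Proof.
move=> sf f0 sg g0 eqP_mem QP; apply: perm_lc_eq.
have sf' : is_surjw (destutter f) by rewrite surjw_destutter.
have sg' : is_surjw (destutter g) by rewrite surjw_destutter.
have n0 : 0 < size (destutter f) by rewrite size_destutter_gt0.
have m0 : 0 < size (destutter g) by rewrite size_destutter_gt0.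
rewrite (phi_surjw sf) (phi_surjw sg) !Msize_blocks // in QP *.
set n := size f; set m := size g.
set n' := size (destutter f) in QP n0 *; set m' := size (destutter g) in QP m0 *.
set A := [seq w <- surjwords _ | _].
(* The bijection on index sets; its second component records whether the letters at the cut
   differ. *)
pose F w := (blocks (destutter w),
             n' + (last 0 (take n w) != head 0 (drop n w))).
have AP w : w \in A ->
  [/\ is_surjw w, 0 < size (take n w), 0 < size (drop n w) &
   [/\ stdw (take n w) = f, stdw (drop n w) = g,
       size (destutter (take n w)) = n', size (destutter (drop n w)) = m' &
       P (take n w) (drop n w)]].
  rewrite mem_filter mem_surjwords => /and3P[/and3P[/eqP ef /eqP eg Pw] /eqP sz sw].
  split=> //; first by rewrite size_takel // sz leq_addr.
    by rewrite size_drop sz addKn.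
  (* Standardization preserves length and commutes with destuttering, so the lengths of the
     destuttered parts are those of [destutter f] and [destutter g]. *)
  by split=> //; rewrite -(size_stdw (destutter _)) stdw_destutter ?ef ?eg.
have FP w : w \in A -> let v := destutter w in let lo := (F w).2 in
  [/\ take n' v = destutter (take n w), drop lo.-1 v = destutter (drop n w),
      size v = lo.-1 + m', n' <= size v & 0 < lo <= n'.+1].
  case/AP=> sw h0 k0 [_ _ sh sk _]; rewrite /F /=.
  have := drop_destutter_cat 0 h0 k0; have := take_destutter_cat h0 k0.
  rewrite cat_take_drop sh => T H.
  have := congr1 size T; have := congr1 size H.
  rewrite size_drop size_take_min sh sk => sH sT.
  split=> //; move: n0 m0 sH sT; clearbody n' m'; case: (_ != _) => /=;
    move: (size (destutter w)) => N; lia.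
have -> : lc_map phi [seq (e (capw (take n w) (drop n w)), w) | w <- A]
  = [seq (e (capM n' m' p.2 p.1), p.1) | p <- map F A].
  rewrite /lc_map -!map_comp; apply/eq_in_map => w wA /=.
  have [sw _ _ _] := AP w wA; have [eh ek sz le lob] := FP w wA.
  rewrite phi_surjw // capM_blocks ?surjw_destutter //; last by case/andP: lob.
  rewrite eh ek; congr (e _, _).
  by apply: eq_capw => x; rewrite mem_destutter.
apply: perm_map; apply: uniq_perm.
- rewrite map_inj_in_uniq; first exact/filter_uniq/surjwords_uniq.
  move=> w1 w2 w1A w2A eF.
  have [sw1 _ _ [ef1 eg1 _ _ _]] := AP _ w1A.
  have [sw2 _ _ [ef2 eg2 _ _ _]] := AP _ w2A.
  have [eh1 ek1 _ _ _] := FP _ w1A; have [eh2 ek2 _ _ _] := FP _ w2A.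
  have ed : destutter w1 = destutter w2.
    have [e1 _] := eF.
    by apply: blocks_inj e1; rewrite -topredE /= surjw_destutter.
  (* The second component of [F] locates the suffix, so both destuttered parts agree; with the
     prescribed standardizations they determine both parts of the word. *)
  rewrite -(cat_take_drop n w1) -(cat_take_drop n w2); congr (_ ++ _).
    by apply: stdw_destutter_inj; rewrite ?ef1 ?ef2 // -eh1 -eh2 ed.
  by apply: stdw_destutter_inj; rewrite ?eg1 ?eg2 // -ek1 -ek2 ed eF.
- exact/filter_uniq/Wset_uniq.
move=> p; rewrite mem_filter; apply/mapP/andP => [[w wA ->]|[Qp]].
  have [sw h0 k0 [ef eg sh sk Pw]] := AP w wA.
  have [eh ek sz le lob] := FP w wA.
  split.
    rewrite /F (QP _ (F w).2) ?surjw_destutter // eh ek.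
    by rewrite (eqP_mem _ _ _ _ (mem_destutter _) (mem_destutter _)).
  apply/WsetP => //; first exact: smirnov_destutter.
  exists (destutter w), (last 0 (take n w) != head 0 (drop n w)).
  split=> //; first by rewrite surjw_destutter.
    exact: smirnov_destutter.
  by split=> //; rewrite ?eh ?ek stdw_destutter ?ef ?eg.
case/WsetP=> //; first exact: smirnov_destutter.
move=> v [b [sv mv sz [ef eg ep]]].
(* The preimage is [h ++ k]: the two possibly overlapping parts of [v] are unstuttered separately to
   patterns [f] and [g], and gluing returns [v] and [b]. *)
have [h hf dh] := unstutter ef; have [k kg dk] := unstutter eg.
have [dhk eb] := destutter_glue 0 mv n0 m0 sz dh dk.
have szh : size h = n by rewrite -(size_stdw h) hf.
have szk : size k = m by rewrite -(size_stdw k) kg.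
have th : take n (h ++ k) = h by rewrite take_size_cat.
have dk' : drop n (h ++ k) = k by rewrite drop_size_cat.
exists (h ++ k); last by rewrite /F th dk' dhk eb ep.
rewrite mem_filter mem_surjwords th dk' hf kg !eqxx /=.
rewrite size_cat szh szk eqxx -surjw_destutter dhk sv !andbT.
move: Qp; rewrite ep QP //.
- by rewrite -dh -dk (eqP_mem _ _ _ _ (mem_destutter _) (mem_destutter _)).
- by rewrite -/n'; case: (b); lia.
by rewrite sz -/n' -/m'; case: (b); lia.
Qed.

Lemma eq_maxw_rel (r : rel nat) h k h' k' : h =i h' -> k =i k' ->
  r (maxw h) (maxw k) = r (maxw h') (maxw k').
Proof. by move=> /eq_maxw -> /eq_maxw ->. Qed.

(** The last block is the fiber of the largest letter, and [lo <= n.+1] ensures that prefix and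
    suffix together cover [v], so [maxw_cover] applies. *)
Lemma last_block_has v n m lo : is_surjw v -> 0 < n -> 0 < m ->
  0 < lo <= n.+1 -> n <= size v -> size v = lo.-1 + m ->
  (has (fun x => x <= n) (last [::] (blocks v))
     = (maxw (drop lo.-1 v) <= maxw (take n v))) *
  (has (inS lo m) (last [::] (blocks v))
     = (maxw (take n v) <= maxw (drop lo.-1 v))).
Proof.
move=> sv n0 m0 /andP[lo0 lon] le sz; rewrite last_blocks //; last by lia.
rewrite has_leq_block // has_inS_block //.
have sh : 0 < size (take n v) by rewrite size_takel.
have sk : 0 < size (drop lo.-1 v) by rewrite size_drop; lia.
apply: maxw_cover => // x; rewrite mem_cat; apply/idP/orP => [|[/mem_take|/mem_drop]//].
rewrite -{1}(cat_take_drop n v) mem_cat => /orP[->|xd]; [by left | right].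
(* As [lo.-1 <= n], the rest after the prefix is a suffix of [drop lo.-1 v]. *)
by move: xd; rewrite (_ : n = (n - lo.-1) + lo.-1) -?drop_drop => [/mem_drop|]; lia.
Qed.

Theorem theorem3p4 (R : fieldType) (q : R) :
  (forall (n : nat) (B : seq (seq nat)), (0 < n)%N -> is_Mperm n B ->
     exists f : seq nat, [/\ is_surjw f, (0 < size f)%N & phi f = B]) /\
  (forall f g : seq nat,
     is_surjw f -> (0 < size f)%N -> is_surjw g -> (0 < size g)%N ->
     [/\ lc_eq (lc_map phi (ST_prec q f g)) (M_prec q (phi f) (phi g)),
         lc_eq (lc_map phi (ST_dot q f g)) (M_dot q (phi f) (phi g)),
         lc_eq (lc_map phi (ST_succ q f g)) (M_succ q (phi f) (phi g)) &
         lc_eq (lc_map (fun p => (phi p.1, phi p.2)) (ST_cop R f))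
               (M_cop R (phi f))]).
Proof.
split=> [n B n0 /phi_onto[f [sf sz eB]]|f g sf f0 sg g0].
  by exists f; rewrite sz.
have n0 : 0 < Msize (phi f).
  by rewrite phi_surjw // Msize_blocks ?size_destutter_gt0 ?surjw_destutter.
have m0 : 0 < Msize (phi g).
  by rewrite phi_surjw // Msize_blocks ?size_destutter_gt0 ?surjw_destutter.
split.
- apply: (@lc_eq_products R (fun c => (q ^+ c)%R)
    (fun h k => maxw k < maxw h)
    (fun p => ~~ has (inS p.2 (Msize (phi g))) (last [::] p.1))) => //.
    by move=> *; apply: (eq_maxw_rel (fun a b => b < a)).
  by move=> v lo sv lob le sz; rewrite (last_block_has sv n0 m0 lob) // -ltnNge.
- apply: (@lc_eq_products R (fun c => (q ^+ c.-1)%R)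
    (fun h k => maxw h == maxw k)
    (fun p => has (fun x => x <= Msize (phi f)) (last [::] p.1)
                   && has (inS p.2 (Msize (phi g))) (last [::] p.1))) => //.
    by move=> *; apply: (eq_maxw_rel eq_op).
  move=> v lo sv lob le sz; rewrite !(last_block_has sv n0 m0 lob) //.
  by rewrite andbC -eqn_leq.
- apply: (@lc_eq_products R (fun c => (q ^+ c)%R)
    (fun h k => maxw h < maxw k)
    (fun p => ~~ has (fun x => x <= Msize (phi f)) (last [::] p.1))) => //.
    by move=> *; apply: (eq_maxw_rel ltn).
  by move=> v lo sv lob le sz; rewrite (last_block_has sv n0 m0 lob) // -ltnNge.
- by rewrite phi_cop.
Qed.
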